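(* Let $n = p_1p_2p_3$ where $p_1<p_2<p_3$ are odd primes satisfying the condition $$p_2 \ge 4(p_1-1)\quad\text{or}\quad p_3\ge p_1^2.$$ Then $$g(\Psi_n) = 2n\,\frac{1}{p_1} - \deg(\Psi_n).$$
   Context: $\Psi_n$ denotes the $n$-th inverse cyclotomic polynomial, $\Psi_n(x) = \prod_{1\le j\le n,\ \gcd(j,n)>1}(x-\zeta_n^j)$, where $\zeta_n$ is a primitive $n$-th root of unity. Maximum gap: for a nonzero univariate polynomial $f = c_1x^{e_1}+\cdots+c_tx^{e_t}$ with $c_1,\ldots,c_t\neq 0$ and $e_1<\cdots<e_t$, the maximum gap of $f$ is $g(f) = \max_{1\le i<t}(e_{i+1}-e_i)$, with $g(f)=0$ when $t=1$. *)

(* Defs.v *)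
From mathcomp Require Export all_boot all_order all_algebra all_field.

Set Implicit Arguments.
Unset Strict Implicit.
Unset Printing Implicit Defensive.

Import Order.TTheory GRing.Theory Num.Theory.

Local Open Scope ring_scope.

(* Meant for n.-primitive_root z, in the style of [cyclotomic z n]. *)
Definition inv_cyclotomic (R : nzRingType) (z : R) (n : nat) : {poly R} :=
  \prod_(1 <= j < n.+1 | (1 < gcdn j n)%N) ('X - (z ^+ j)%:P).

Definition exponents (R : nzSemiRingType) (f : {poly R}) : seq nat :=
  [seq i <- iota 0 (size f) | f`_i != 0].

(* The exponents increase strictly, so the truncated subtraction is exact;
   the empty maximum gives 0 when f has at most one term. *)
Definition max_gap (R : nzSemiRingType) (f : {poly R}) : nat :=
  let e := exponents f in
  (\max_(i < (size e).-1) (nth 0 e i.+1 - nth 0 e i))%N.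

Definition pdeg (R : nzSemiRingType) (f : {poly R}) : nat := (size f).-1.

(* Main.v *)
(** Write [m = p1 - 1].  Splitting the roots of [Psi_n] according to whether
    [p1] divides the exponent gives [Psi_n = (X^(p2 p3) - 1) A] with
      [A (1 + X + ... + X^m) = \sum_(i, j <= m) X^(i p2 + j p3)].
    Since [deg A = m (p2 + p3 - 1) < p2 p3], [Psi_n] consists of two disjoint
    copies of [A], and the hole between them is the announced gap [G].  No gap
    inside [A] is larger: the coefficients on the right are nonnegative, so
    every [s = i p2 + j p3] forces a nonzero coefficient of [A] in
    [[s - m, s]]; and such [s] occur in every interval of length
    [max(p2, p3 - m p2)], which is at most [G - m]. *)
Require Import Defs.
From mathcomp Require Import all_boot all_order all_algebra all_field.
From mathcomp Require Import zify ring.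

Set Implicit Arguments.
Unset Strict Implicit.
Unset Printing Implicit Defensive.

Import Order.TTheory GRing.Theory Num.Theory.

Local Open Scope ring_scope.

(** * Gaps read off the coefficients *)

Lemma mem_exponents (R : nzSemiRingType) (f : {poly R}) i :
  (i \in exponents f) = (f`_i != 0).
Proof.
rewrite mem_filter mem_iota add0n /=; case: (ltnP i (size f)) => [_|le_fi].
  by rewrite andbT.
by rewrite andbF nth_default ?eqxx.
Qed.

Lemma nth_exponents_lt (R : nzSemiRingType) (f : {poly R}) i j :
  (i < j)%N -> (j < size (exponents f))%N ->
  (nth 0 (exponents f) i < nth 0 (exponents f) j)%N.
Proof.
move=> lt_ij lt_j; apply: (sorted_ltn_nth ltn_trans) => //; last 1 first.
- by rewrite inE; apply: ltn_trans lt_j.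
by apply: sorted_filter; [exact: ltn_trans | exact: iota_ltn_sorted].
Qed.

Lemma max_gap_leP (R : nzSemiRingType) (f : {poly R}) G :
  (forall a b, (a < b)%N -> f`_a != 0 -> f`_b != 0 ->
     (forall c, (a < c < b)%N -> f`_c = 0) -> (b - a <= G)%N) ->
  (max_gap f <= G)%N.
Proof.
move=> gapG; apply/bigmax_leqP => i _.
have lt_i1 : (i.+1 < size (exponents f))%N by have := ltn_ord i; lia.
have lt_i : (i < size (exponents f))%N by lia.
have nthP k : (k < size (exponents f))%N -> f`_(nth 0%N (exponents f) k) != 0.
  by move=> ltk; rewrite -mem_exponents mem_nth.
have mono := @nth_exponents_lt R f.
apply: gapG; rewrite ?nthP //; first exact: mono.
move=> c /andP[lt_ac lt_cb]; apply/eqP/negPn; rewrite -mem_exponents.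
(* An exponent [c] between two consecutive ones would have an index in the sorted list; strict
   monotonicity of [nth] excludes an index at most [i] as well as one at least [i.+1]. *)
apply/negP => ec; have ltc : (index c (exponents f) < size (exponents f))%N.
  by rewrite index_mem.
have : nth 0%N (exponents f) (index c (exponents f)) = c by exact: nth_index.
case: (ltngtP (index c (exponents f)) i.+1).
- rewrite ltnS leq_eqVlt => /orP[/eqP->|lt_ci] nc; first by lia.
  by have := mono _ _ lt_ci lt_i; lia.
- by move=> lt_ic nc; have := mono _ _ lt_ic ltc; lia.
- by move=> -> nc; lia.
Qed.

Lemma leq_max_gap (R : nzSemiRingType) (f : {poly R}) a b :
  (a < b)%N -> f`_a != 0 -> f`_b != 0 ->
  (forall c, (a < c < b)%N -> f`_c = 0) -> (b - a <= max_gap f)%N.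
Proof.
move=> lt_ab fa fb hole; move: (fa) (fb); rewrite -!mem_exponents => ea eb.
have lt_a : (index a (exponents f) < size (exponents f))%N by rewrite index_mem.
have lt_b : (index b (exponents f) < size (exponents f))%N by rewrite index_mem.
have mono := @nth_exponents_lt R f.
have lt_iab : (index a (exponents f) < index b (exponents f))%N.
  rewrite ltnNge leq_eqVlt; apply/negP => /orP[/eqP eq_ba|lt_ba].
    by move: lt_ab; rewrite -(nth_index 0%N ea) -(nth_index 0%N eb) eq_ba ltnn.
  by have := mono _ _ lt_ba lt_a; rewrite !nth_index // ltnNge ltnW.
have lt_a1 : ((index a (exponents f)).+1 < size (exponents f))%N by lia.
have lt_ai : (index a (exponents f) < (size (exponents f)).-1)%N by lia.
apply: (bigop.bigmax_sup (Ordinal lt_ai)) => //=.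
have -> : nth 0%N (exponents f) (index a (exponents f)) = a by exact: nth_index.
rewrite leq_sub2r //.
(* If the exponent listed right after [a] were below [b], it would lie in the hole. *)
rewrite leqNgt; apply/negP => lt_nb.
have := mem_nth 0%N lt_a1; rewrite mem_exponents hole ?eqxx // lt_nb andbT.
by have := mono _ _ (ltnSn _) lt_a1; rewrite nth_index.
Qed.

(** * Subproducts of [X^n - 1] over roots of unity *)

Lemma prod_prim_root_dvd (F : fieldType) (n d m : nat) (z : F) :
  n.-primitive_root z -> n = (d * m)%N ->
  \prod_(1 <= j < n.+1 | (d %| j)%N) ('X - (z ^+ j)%:P) = 'X^m - 1.
Proof.
move=> prim_z def_n; have n_gt0 := prim_order_gt0 prim_z.
have d_gt0 : (0 < d)%N by move: n_gt0; rewrite def_n muln_gt0 => /andP[].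
have m_gt0 : (0 < m)%N by move: n_gt0; rewrite def_n muln_gt0 => /andP[].
have dvd_mn : (m %| n)%N by rewrite def_n dvdn_mull.
have prim_zd := dvdn_prim_root prim_z dvd_mn.
rewrite {1}def_n mulnK // in prim_zd.
rewrite -(factor_Xn_sub_1 prim_zd).
(* The multiples of [d] in [1..n] are the [d * k] with [1 <= k <= m], and [z ^+ d] is a primitive
   [m]-th root of unity. *)
transitivity (\prod_(1 <= k < m.+1) ('X - ((z ^+ d) ^+ k)%:P)).
  have -> : \prod_(1 <= k < m.+1) ('X - ((z ^+ d) ^+ k)%:P) =
      \prod_(j <- [seq (d * k)%N | k <- index_iota 1 m.+1]) ('X - (z ^+ j)%:P).
    by rewrite big_map; apply: eq_bigr => k _; rewrite exprM.
  rewrite -big_filter; apply: perm_big; apply: uniq_perm.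
  - by rewrite filter_uniq ?iota_uniq.
  - rewrite map_inj_uniq ?iota_uniq // => i j /eqP.
    by rewrite eqn_pmul2l // => /eqP.
  move=> j; rewrite mem_filter mem_index_iota; apply/andP/mapP.
    move=> [/dvdnP[k ->] bnd]; exists k; last by rewrite mulnC.
    by rewrite mem_index_iota; move: bnd; rewrite def_n; nia.
  move=> [k]; rewrite mem_index_iota => bnd ->; split; first exact: dvdn_mulr.
  by rewrite def_n; nia.
(* The ranges [1..m] and [0..m-1] differ in their end terms, which agree because
   [(z ^+ d) ^+ m = 1]. *)
by rewrite big_nat_recr // [RHS]big_ltn //= (prim_expr_order prim_zd) expr0 mulrC.
Qed.

(** The multiples of [d] contribute [X^(m p) - 1], those of [d p] contribute [X^m - 1]; the quotient
    is a geometric sum. *)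
Lemma prod_prim_root_dvd_ndvd (F : fieldType) (n d p m : nat) (z : F) :
  n.-primitive_root z -> n = (d * (m * p))%N -> coprime d p ->
  \prod_(1 <= j < n.+1 | (d %| j)%N && ~~ (p %| j)%N) ('X - (z ^+ j)%:P) =
    \sum_(i < p) 'X^m ^+ i.
Proof.
move=> prim_z def_n co_dp; have n_gt0 := prim_order_gt0 prim_z.
have m_gt0 : (0 < m)%N by move: n_gt0; rewrite def_n !muln_gt0 => /and3P[].
have def_n' : n = (d * p * m)%N by lia.
have all_d := prod_prim_root_dvd prim_z def_n.
rewrite (bigID (fun j => (p %| j)%N)) /= in all_d.
rewrite (eq_bigl (fun j => (d * p %| j)%N)) in all_d; last first.
  by move=> j; rewrite Gauss_dvd.
rewrite (prod_prim_root_dvd prim_z def_n') in all_d.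
apply: (@mulfI _ ('X^m - 1)); last by rewrite all_d exprM subrX1.
by rewrite -size_poly_eq0 size_XnsubC.
Qed.

(** * Geometric sums and the values [a i + b j] *)

Lemma size_geometric_Xn (F : fieldType) (m p : nat) :
  (0 < m)%N -> (0 < p)%N ->
  size (\sum_(i < p) 'X^m ^+ i : {poly F}) = (m * p.-1).+1.
Proof.
move=> m_gt0 p_gt0; have := subrX1 ('X^m : {poly F}) p; rewrite -exprM.
set S := \sum_(_ < _) _ => eS.
have szN k : (0 < k)%N -> size ('X^k - 1 : {poly F}) = k.+1.
  by move=> k_gt0; rewrite size_XnsubC.
have nz : ('X^m - 1) * S != 0.
  by rewrite -eS -size_poly_eq0 szN // muln_gt0 m_gt0.
have szS : (size S > 0)%N.
  by rewrite lt0n size_poly_eq0; apply: contraNneq nz => ->; rewrite mulr0.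
have := congr1 (size : {poly F} -> nat) eS.
rewrite szN ?muln_gt0 ?m_gt0 // size_mul ?szN //=.
- have -> : (m * p).+1 = (m + (m * p.-1).+1)%N by nia.
  by move/addnI.
- by rewrite -size_poly_eq0 szN.
- by rewrite -size_poly_gt0.
Qed.

Lemma coef_mul_geometric (R : comNzRingType) (A : {poly R}) p s :
  (A * \sum_(i < p) 'X^1 ^+ i)`_s != 0 ->
  exists t, [/\ (t < p)%N, (t <= s)%N & A`_(s - t) != 0].
Proof.
rewrite big_distrr coef_sum /= => nz.
have [i] : exists i : 'I_p, (A * 'X^1 ^+ i)`_s != 0.
  apply/existsP; apply: contraNT nz; rewrite negb_exists => /forallP z.
  by rewrite big1 // => i _; apply/eqP; have := z i; rewrite negbK.
rewrite expr1 coefMXn; case: ltnP => [_|le_is nzi]; first by rewrite eqxx.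
by exists i.
Qed.

(** The coefficient counts the pairs [(u, v)] with [a u + b v = a i + b j]. Nothing cancels, and
    [(i, j)] itself is counted. *)
Lemma coef_geometric_mul_neq0 (R : numDomainType) (a b p i j : nat) :
  (i < p)%N -> (j < p)%N ->
  ((\sum_(u < p) 'X^a ^+ u) * (\sum_(v < p) 'X^b ^+ v) : {poly R})`_(a * i + b * j)
    != 0.
Proof.
move=> lt_i lt_j; rewrite big_distrl coef_sum /=.
have term (u : 'I_p) : ('X^a ^+ u * \sum_(v < p) 'X^b ^+ v : {poly R})`_(a * i + b * j)
    = \sum_(v < p) (a * i + b * j == a * u + b * v)%N%:R.
  rewrite big_distrr coef_sum; apply: eq_bigr => v _ /=.
  by rewrite -!exprM -exprD coefXn.
rewrite (eq_bigr _ (fun u _ => term u)) gt_eqF //.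
rewrite (bigD1 (Ordinal lt_i)) //= (bigD1 (Ordinal lt_j)) //= eqxx.
rewrite -addrA ltr_pwDl ?ltr01 // addr_ge0 ?sumr_ge0 // => u _.
by rewrite sumr_ge0.
Qed.

(** Greedy choice: the least [j] for which [a m + b j] reaches [s], then the least [i] for which
    [a i + b j] does. *)
Lemma double_progression_dense (a b m L s : nat) :
  (0 < a)%N -> (a <= L)%N -> (b <= L + a * m)%N -> (s <= a * m + b * m)%N ->
  exists i j, [/\ (i <= m)%N, (j <= m)%N & (s <= a * i + b * j < s + L)%N].
Proof.
move=> a_gt0 le_aL le_bL le_s.
have exj : exists j, (s <= a * m + b * j)%N by exists m.
case: (ex_minnP exj) => j le_j minj; have le_jm := minj _ le_s.
have exi : exists i, (s <= a * i + b * j)%N by exists m.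
case: (ex_minnP exi) => i le_i mini; have le_im := mini _ le_j.
exists i, j; split=> //; rewrite le_i /=.
(* If [i > 0], minimality of [i] makes the overshoot less than [a]. If [i = 0 < j], minimality of
   [j] makes it less than [b - a m]. If both vanish, [s = 0]. *)
case: i le_i mini {le_im} => [|i] le_i mini; last first.
  by case: (leqP s (a * i + b * j)) => [/mini|]; lia.
case: j {le_j exi mini le_i le_jm} minj => [|j] minj; first by nia.
by case: (leqP s (a * m + b * j)) => [/minj|]; lia.
Qed.

(** * The factorization of [Psi_n] and the numerical condition *)

Lemma inv_cyclotomic_factor (n p1 p2 p3 : nat) (z : algC) :
  prime p1 -> prime p2 -> prime p3 -> p1 != p2 -> p1 != p3 -> p2 != p3 ->
  n = (p1 * p2 * p3)%N -> n.-primitive_root z ->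
  exists2 A : {poly algC},
    inv_cyclotomic z n = ('X^(p2 * p3) - 1) * A &
    A * (\sum_(i < p1) 'X^1 ^+ i) =
      (\sum_(i < p1) 'X^p2 ^+ i) * (\sum_(i < p1) 'X^p3 ^+ i).
Proof.
move=> pr1 pr2 pr3 ne12 ne13 ne23 def_n prim_z.
have co21 : coprime p2 p1 by rewrite prime_coprime // dvdn_prime2 // eq_sym.
have co31 : coprime p3 p1 by rewrite prime_coprime // dvdn_prime2 // eq_sym.
have co23 : coprime p2 p3 by rewrite prime_coprime // dvdn_prime2.
have not_coprime j : (1 < gcdn j n)%N = [|| (p1 %| j)%N, (p2 %| j)%N | (p3 %| j)%N].
  have g_gt0 : (0 < gcdn j n)%N by rewrite gcdn_gt0 (prim_order_gt0 prim_z) orbT.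
  have -> : (1 < gcdn j n)%N = ~~ coprime j n by rewrite /coprime; lia.
  rewrite def_n !coprimeMr ![coprime j _]coprime_sym !prime_coprime //.
  by rewrite !negb_and !negbK orbA.
exists (\prod_(1 <= j < n.+1 | ((p2 %| j)%N || (p3 %| j)%N) && ~~ (p1 %| j)%N)
          ('X - (z ^+ j)%:P)).
  rewrite /inv_cyclotomic (bigID (fun j => (p1 %| j)%N)) /=; congr (_ * _).
    rewrite -(@prod_prim_root_dvd _ n p1 (p2 * p3) z) // ?mulnA //.
    by apply: eq_bigl => j; rewrite not_coprime; case: (p1 %| j)%N; rewrite ?andbF.
  by apply: eq_bigl => j; rewrite not_coprime; case: (p1 %| j)%N; rewrite ?andbF.
rewrite -(@prod_prim_root_dvd_ndvd _ n (p2 * p3) p1 1 z) //; first last.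
- by rewrite coprimeMl co21.
- by rewrite def_n; lia.
rewrite -(@prod_prim_root_dvd_ndvd _ n p3 p1 p2 z) //; last by rewrite def_n; lia.
rewrite -(@prod_prim_root_dvd_ndvd _ n p2 p1 p3 z) //; last by rewrite def_n; lia.
(* Among the [j] prime to [p1], let [P2] and [P3] be the multiples of [p2] and of [p3]. The claim is
   that the products over their union and intersection multiply to the products over [P2] and [P3],
   checked factor by factor. *)
rewrite ![\prod_(_ <= _ < _ | _) _]big_mkcond -!big_split; apply: eq_bigr => j _.
rewrite Gauss_dvd //=.
by case: (p1 %| j)%N; case: (p2 %| j)%N; case: (p3 %| j)%N;
  rewrite /= ?mulr1 ?mul1r.
Qed.

(** This is where the condition on the primes enters, with [m = p1 - 1]: it makes the middle gap at
    least [p2 + m]. *)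
Lemma middle_gap_large (m p2 p3 : nat) :
  (1 < m)%N -> (m + 3 <= p2)%N -> (p2 < p3)%N ->
  ((4 * m <= p2)%N \/ (m.+1 ^ 2 <= p3)%N) ->
  (p2 * m + p3 * m + p2 <= p2 * p3)%N.
Proof.
move=> m_gt1 lt_mp2 lt23 [le_4m | le_sqr].
  (* The term [p3 m] is at most a quarter of [p2 p3], and [p2 (m + 1)] at most half of it. *)
  have : (p3 * (4 * m) <= p3 * p2)%N by rewrite leq_mul2l le_4m orbT.
  have : (p2 * (2 * m.+1) <= p2 * p3)%N by rewrite leq_mul2l; lia.
  by lia.
(* After subtracting [p3 m], the claim is [(m + d)(m + 1) <= p3 d], which follows from
   [(m + 1)^2 d <= p3 d]. *)
have [d def_p2] : exists d, p2 = (m + d)%N by exists (p2 - m)%N; lia.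
have : (m.+1 ^ 2 * d <= p3 * d)%N by rewrite leq_mul2r le_sqr orbT.
by rewrite def_p2; nia.
Qed.

(** * The support of [A] and the gaps of [Psi_n] *)

Lemma geometric_quotient_size (F : fieldType) (A : {poly F}) (m a b : nat) :
  (0 < a)%N -> (0 < b)%N ->
  A * (\sum_(i < m.+1) 'X^1 ^+ i) =
    (\sum_(i < m.+1) 'X^a ^+ i) * (\sum_(i < m.+1) 'X^b ^+ i) ->
  (size A + m = (a * m + b * m).+1)%N.
Proof.
move=> a_gt0 b_gt0 defA.
have nzS k : (0 < k)%N -> (\sum_(i < m.+1) 'X^k ^+ i : {poly F}) != 0.
  by move=> k_gt0; rewrite -size_poly_gt0 size_geometric_Xn.
have nzA : A != 0.
  apply: contraTneq (mulf_neq0 (nzS _ a_gt0) (nzS _ b_gt0)) => A0.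
  by rewrite -defA A0 mul0r eqxx.
have := congr1 (size : {poly F} -> nat) defA.
rewrite (size_mul nzA (nzS _ (ltn0Sn 0))) (size_mul (nzS _ a_gt0) (nzS _ b_gt0)).
by rewrite !size_geometric_Xn //= !addnS mul1n.
Qed.

(** Each coefficient of the left side sums [A] over a window of [m + 1] exponents, so a nonzero sum
    forces a nonzero entry. *)
Lemma geometric_quotient_near (R : numDomainType) (A : {poly R}) (m a b i j : nat) :
  A * (\sum_(i < m.+1) 'X^1 ^+ i) =
    (\sum_(i < m.+1) 'X^a ^+ i) * (\sum_(i < m.+1) 'X^b ^+ i) ->
  (i <= m)%N -> (j <= m)%N ->
  exists t, [/\ (t <= m)%N, (t <= a * i + b * j)%N & A`_(a * i + b * j - t) != 0].
Proof.
move=> defA le_i le_j; have := @coef_geometric_mul_neq0 R a b m.+1 i j le_i le_j.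
by rewrite -defA => /coef_mul_geometric[t [lt_t le_t nzt]]; exists t.
Qed.

Lemma max_gap_Xn_sub_1_mul (R : idomainType) (A : {poly R}) (D N : nat) :
  size A = D.+1 -> A`_0 != 0 -> (D < N)%N ->
  (forall a b, (a + (N - D) < b <= D)%N -> exists2 c, (a < c < b)%N & A`_c != 0) ->
  max_gap (('X^N - 1) * A) = (N - D)%N.
Proof.
move=> szA A_0 lt_DN A_dense; set f := _ * A.
have A_high k : (D < k)%N -> A`_k = 0 by move=> lt_k; rewrite nth_default ?szA.
have A_D : A`_D != 0.
  have : lead_coef A != 0 by rewrite lead_coef_eq0 -size_poly_gt0 szA.
  by rewrite /lead_coef szA.
have coef_f k : f`_k = (if (k < N)%N then - A`_k else A`_(k - N)).
  rewrite /f mulrBl mul1r coefB coefXnM; case: ltnP => le_k; rewrite ?sub0r //.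
  by rewrite [X in _ - X]A_high ?subr0 //; lia.
have f_low k : (k < N)%N -> f`_k != 0 -> (k <= D)%N /\ A`_k != 0.
  move=> lt_k; rewrite coef_f lt_k oppr_eq0 => nz; split=> //.
  by rewrite leqNgt; apply: contra nz => lt_D; rewrite A_high.
have f_high k : (N <= k)%N -> f`_k != 0 -> (k - N <= D)%N.
  move=> le_k; rewrite coef_f ltnNge le_k /= => nz.
  by rewrite leqNgt; apply: contra nz => lt_D; rewrite A_high.
have f_lowI k : (k < N)%N -> A`_k != 0 -> f`_k != 0.
  by move=> lt_k; rewrite coef_f lt_k oppr_eq0.
have f_highI k : A`_k != 0 -> f`_(k + N) != 0.
  by rewrite coef_f ltnNge leq_addl /= addnK.
apply/eqP; rewrite eqn_leq; apply/andP; split; last first.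
  apply: leq_max_gap => //; [exact: f_lowI | exact: (f_highI 0) |].
  move=> c bnd; apply/eqP/negPn/negP => nzc.
  by have [] := f_low c _ nzc; lia.
apply: max_gap_leP => a b lt_ab nza nzb hole; rewrite leqNgt; apply/negP => big_gap.
have no_exp c : (a < c < b)%N -> f`_c != 0 -> False by move=> /hole->; rewrite eqxx.
have [lt_bN|le_Nb] := ltnP b N.
  have [le_bD _] := f_low b lt_bN nzb.
  have [|c bnd nzc] := A_dense a b; first by lia.
  by apply: (no_exp c bnd); apply: f_lowI => //; lia.
have le_bD := f_high b le_Nb nzb.
(* A gap with [a < N <= b] has [a <= D]. If [b > N], then [N] lies inside it; if [b = N], its length
   above [N - D] puts [D] inside it. *)
have [lt_aN|le_Na] := ltnP a N.
  have [le_aD _] := f_low a lt_aN nza.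
  have [eq_bN|ne_bN] := eqVneq b N.
    by apply: (no_exp D); [lia | exact: f_lowI].
  by apply: (no_exp N); [lia | exact: (f_highI 0)].
have [|c bnd nzc] := A_dense (a - N)%N (b - N)%N; first by lia.
by apply: (no_exp (c + N)%N); [lia | exact: f_highI].
Qed.

Theorem theorem2 (n p1 p2 p3 : nat) (z : algC) :
  prime p1 -> prime p2 -> prime p3 ->
  odd p1 -> odd p2 -> odd p3 ->
  (p1 < p2)%N -> (p2 < p3)%N ->
  n = (p1 * p2 * p3)%N ->
  ((4 * (p1 - 1) <= p2)%N \/ (p1 ^ 2 <= p3)%N) ->
  n.-primitive_root z ->
  (max_gap (inv_cyclotomic z n))%:R =
    2 * n%:R * (1 / p1%:R) - (pdeg (inv_cyclotomic z n))%:R :> rat.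
Proof.
move=> pr1 pr2 pr3 odd1 odd2 odd3 lt12 lt23 def_n cond prim_z.
have p1_gt2 : (2 < p1)%N by have := prime_gt1 pr1; move: odd1; case: p1 {pr1 lt12 def_n cond} => [|[|[|]]].
have [A defPsi defA] := inv_cyclotomic_factor pr1 pr2 pr3
  (ltac:(lia)) (ltac:(lia)) (ltac:(lia)) def_n prim_z.
have [m def_m] : exists m, p1 = m.+1 by exists p1.-1; lia.
have [p2_gt0 p3_gt0] : (0 < p2)%N /\ (0 < p3)%N by split; lia.
pose D := (m * (p2 + p3 - 1))%N; pose N := (p2 * p3)%N.
have DmE : (D + m = p2 * m + p3 * m)%N.
  rewrite /D -[X in (_ + X)%N]muln1 -mulnDr mulnC subnK ?mulnDl //.
  by rewrite addn_gt0 p2_gt0.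
have le_p2 : (D + m + p2 <= N)%N.
  rewrite DmE; apply: middle_gap_large => //; [by lia | by lia |].
  by move: cond; rewrite def_m subn1.
(* Since [m + 1 = p1], this reduces to [p1 p3 <= p2 p3]. *)
have le_p3 : (D + m + p3 <= N + p2 * m)%N.
  by rewrite DmE -addnA addnC leq_add2r -mulnSr [N]mulnC leq_mul2l -def_m
    (ltnW lt12) orbT.
rewrite -/N in defPsi; rewrite def_m in defA.
have szA : size A = D.+1.
  have := geometric_quotient_size p2_gt0 p3_gt0 defA.
  by rewrite -DmE -addSn => /addIn.
have szPsi : size (inv_cyclotomic z n) = (N + D).+1.
  have szN : size ('X^N - 1 : {poly algC}) = N.+1.
    by rewrite size_XnsubC // muln_gt0 p2_gt0.
  by rewrite defPsi size_mul -?size_poly_gt0 ?szN ?szA //= addnS.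
have near := geometric_quotient_near defA.
have gapPsi : max_gap (inv_cyclotomic z n) = (N - D)%N.
  rewrite defPsi; apply: max_gap_Xn_sub_1_mul => //.
  - by have [t [_]] := near 0 0 isT isT; rewrite !muln0.
  - by apply: leq_trans le_p2; rewrite -addnA -[leqLHS]addn1 leq_add2l addn_gt0 p2_gt0 orbT.
  move=> a b bnd.
  clear - DmE le_p2 le_p3 bnd near p2_gt0; clearbody D N.
  (* Starting the window at [a + m + 1] keeps the exponent above [a] after subtracting [t <= m]; the
     length [N - D - m] keeps it below [b]. *)
  have [|||i [j [le_i le_j bnd_s]]] :=
      @double_progression_dense p2 p3 m (N - D - m) (a + m + 1) p2_gt0;
    [by lia.. |].
  have [t [le_tm le_ts nzt]] := near _ _ le_i le_j.
  by exists (p2 * i + p3 * j - t)%N => //; lia.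
rewrite gapPsi /pdeg szPsi /= def_n.
have p1_neq0 : p1%:R != 0 :> rat by rewrite pnatr_eq0; lia.
(* Here [2 n / p1 = 2 N] and the degree is [N + D], leaving [N - D]. *)
have -> : 2 * (p1 * p2 * p3)%:R * (1 / p1%:R) = (N + N)%:R :> rat.
  by rewrite natrD !natrM; field.
by rewrite -natrB; last lia; congr _%:R; lia.
Qed.
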